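(* Let $R$ be a semiring. The following statements are equivalent: (i) $R$ is a simple semiring with a projective minimal left ideal; (ii) $R$ is isomorphic either to a matrix semiring $M_n(F)$, $n\ge 1$, over a division ring $F$, or to the endomorphism semiring $\mathbf{E}_M$ of a nonzero finite distributive lattice $M$. The same equivalence holds with ''left ideal'' replaced by ''right ideal'' in (i).
   Context: A semiring $(R,+,\cdot,0,1)$ consists of a commutative monoid $(R,+,0)$ and a monoid $(R,\cdot,1)$ such that multiplication distributes over addition on both sides and $0r=0=r0$ for all $r\in R$. An ideal (left, right ideal) is an additive submonoid closed under two-sided (left, right) multiplication by elements of $R$. $R$ is ideal-simple if $0$ and $R$ are its only ideals; congruence-simple if the diagonal and $R^2$ are its only congruences; simple if it is both. A left $R$-semimodule is a commutative monoid $M$ with a unital, associative scalar multiplication $R\times M\to M$ that is additive in each variable and satisfies $r0_M=0_M=0m$ (right semimodules dually). A semimodule is projective if it is a retract of a free semimodule (a direct sum of copies of the regular semimodule). A minimal left (right) ideal is a nonzero left (right) ideal containing no nonzero left (right) ideal properly; it is projective if it is projective as a left (right) $R$-semimodule. For a lattice $M$ with least element $0$, $\mathbf{E}_M$ is the semiring of all endomorphisms of the monoid $(M,\vee,0)$ with pointwise addition (join) and composition. *)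

(* Defs.v *)
From HB Require Import structures.
From mathcomp Require Import all_boot all_order all_algebra.
From mathcomp Require Import boolp classical_sets cardinality.

Set Implicit Arguments.
Unset Strict Implicit.
Unset Printing Implicit Defensive.

Import Order.TTheory GRing.Theory.
Local Open Scope classical_set_scope.
Local Open Scope ring_scope.

(* Semirings are [pzSemiRingType]s: [1 = 0] is allowed and multiplication need
   not be commutative. *)

Section Ideals.
Variable R : pzSemiRingType.
Implicit Types I J : set R.

Record left_ideal I : Prop := LeftIdeal {
  left_ideal0 : I 0;
  left_idealD : forall x y, I x -> I y -> I (x + y);
  left_idealM : forall r x, I x -> I (r * x) }.

Record right_ideal I : Prop := RightIdeal {
  right_ideal0 : I 0;
  right_idealD : forall x y, I x -> I y -> I (x + y);
  right_idealM : forall r x, I x -> I (x * r) }.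

Definition ideal I : Prop := left_ideal I /\ right_ideal I.

Definition minimal_left_ideal I : Prop :=
  [/\ left_ideal I, I <> [set 0] &
      forall J, left_ideal J -> J <> [set 0] -> J `<=` I -> J = I].

Definition minimal_right_ideal I : Prop :=
  [/\ right_ideal I, I <> [set 0] &
      forall J, right_ideal J -> J <> [set 0] -> J `<=` I -> J = I].

Record congruence (e : R -> R -> Prop) : Prop := Congruence {
  congruence_refl : forall x, e x x;
  congruence_sym : forall x y, e x y -> e y x;
  congruence_trans : forall x y z, e x y -> e y z -> e x z;
  congruenceD : forall x x' y y', e x x' -> e y y' -> e (x + y) (x' + y');
  congruenceM : forall x x' y y', e x x' -> e y y' -> e (x * y) (x' * y') }.

Definition ideal_simple : Prop :=
  forall I, ideal I -> I = [set 0] \/ I = [set: R].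

Definition congruence_simple : Prop :=
  forall e, congruence e ->
    (forall x y, e x y <-> x = y) \/ (forall x y, e x y).

Definition simple_semiring : Prop := ideal_simple /\ congruence_simple.

End Ideals.

(* The direct sum of copies, indexed by [I], of the regular left semimodule:
   functions [I -> R] of finite support. *)
Record free_semimod (R : pzSemiRingType) (I : Type) := FreeSemimod {
  free_coef :> I -> R;
  free_coef_finite : finite_set [set i | free_coef i <> 0] }.

Section FreeSemimod.
Variables (R : pzSemiRingType) (I : Type).
Implicit Types f g h : free_semimod R I.

HB.instance Definition _ := gen_eqMixin (free_semimod R I).
HB.instance Definition _ := gen_choiceMixin (free_semimod R I).

Lemma free_semimodP f g : f =1 g -> f = g.
Proof.
case: f g => [f ff] [g fg] /= /funext fgE; subst g.
by congr FreeSemimod; exact: Prop_irrelevance.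
Qed.

Lemma free0_finite : finite_set [set i : I | (0 : R) <> 0].
Proof. by apply: (sub_finite_set _ (finite_set0 I)) => i /=. Qed.

Lemma freeD_finite f g : finite_set [set i | f i + g i <> 0].
Proof.
apply: sub_finite_set
  (_ : finite_set ([set i | f i <> 0] `|` [set i | g i <> 0])).
  move=> i /= fg0; have [f0|] := pselect (f i = 0); last by left.
  by right => g0; apply: fg0; rewrite f0 g0 addr0.
by rewrite finite_setU; split; exact: free_coef_finite.
Qed.

Lemma freeZ_finite (r : R) f : finite_set [set i | r * f i <> 0].
Proof.
apply: sub_finite_set (free_coef_finite f) => i /= rf0 f0.
by apply: rf0; rewrite f0 mulr0.
Qed.

Definition free0 := FreeSemimod free0_finite.
Definition freeD f g := FreeSemimod (freeD_finite f g).
Definition freeZ (r : R) f := FreeSemimod (freeZ_finite r f).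

Lemma freeDA : associative freeD.
Proof. by move=> f g h; apply: free_semimodP => i /=; exact: addrA. Qed.

Lemma freeDC : commutative freeD.
Proof. by move=> f g; apply: free_semimodP => i /=; exact: addrC. Qed.

Lemma free0D : left_id free0 freeD.
Proof. by move=> f; apply: free_semimodP => i /=; exact: add0r. Qed.

HB.instance Definition _ :=
  GRing.isNmodule.Build (free_semimod R I) freeDA freeDC free0D.

Lemma freeZA a b f : freeZ a (freeZ b f) = freeZ (a * b) f.
Proof. by apply: free_semimodP => i /=; exact: mulrA. Qed.

Lemma free0Z f : freeZ 0 f = 0.
Proof. by apply: free_semimodP => i /=; exact: mul0r. Qed.

Lemma free1Z : left_id 1 freeZ.
Proof. by move=> f; apply: free_semimodP => i /=; exact: mul1r. Qed.

Lemma freeZDr : right_distributive freeZ +%R.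
Proof. by move=> a f g; apply: free_semimodP => i /=; exact: mulrDr. Qed.

Lemma freeZDl f : {morph freeZ^~ f : a b / a + b}.
Proof. by move=> a b; apply: free_semimodP => i /=; exact: mulrDl. Qed.

HB.instance Definition _ :=
  GRing.Nmodule_isLSemiModule.Build R (free_semimod R I)
    freeZA free0Z free1Z freeZDr freeZDl.

End FreeSemimod.

Definition projective (R : pzSemiRingType) (P : lSemiModType R) : Prop :=
  exists (I : Type) (s : {linear P -> free_semimod R I})
         (p : {linear free_semimod R I -> P}), cancel s p.

Section IdealSemimod.
Variables (R : pzSemiRingType) (I : set R) (idI : left_ideal I).

(* The argument [idI] is used only to attach the semimodule structure. *)
Definition ideal_semimod of left_ideal I := {x : R^o | x \in (I : set R^o)}.
Local Notation T := (ideal_semimod idI).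

HB.instance Definition _ := SubChoice.on T.

Lemma ideal_semimod_closed :
  GRing.subsemimod_closed (fun x : R^o => x \in (I : set R^o)).
Proof.
case: idI => I0 ID IM; split; last by move=> r x; rewrite !inE; exact: IM.
by split=> [|x y]; rewrite !inE; [exact: I0 | exact: ID].
Qed.

HB.instance Definition _ :=
  GRing.SubChoice_isSubLSemiModule.Build R R^o
    (fun x : R^o => x \in (I : set R^o)) T ideal_semimod_closed.

End IdealSemimod.

(* Right [R]-semimodules are left semimodules over the converse semiring
   [R^c], in which the product of [x] and [y] is [y * x]. *)
Lemma right_ideal_converse (R : pzSemiRingType) (I : set R) :
  right_ideal I -> left_ideal (I : set R^c).
Proof. by case=> I0 ID IM; split. Qed.

Definition has_projective_minimal_left_ideal (R : pzSemiRingType) : Prop :=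
  exists (I : set R) (idI : left_ideal I),
    minimal_left_ideal I /\ projective (ideal_semimod idI).

Definition has_projective_minimal_right_ideal (R : pzSemiRingType) : Prop :=
  exists (I : set R) (idI : right_ideal I),
    minimal_right_ideal I /\
    projective (ideal_semimod (right_ideal_converse idI)).

Record join_endo d (M : bLatticeType d) := JoinEndo {
  join_endo_fun :> M -> M;
  join_endo0 : join_endo_fun \bot%O = \bot%O;
  join_endoU : {morph join_endo_fun : x y / (x `|` y)%O} }.

Section JoinEndo.
Variables (d : Order.disp_t) (M : bLatticeType d).
Implicit Types f g h : join_endo M.

HB.instance Definition _ := gen_eqMixin (join_endo M).
HB.instance Definition _ := gen_choiceMixin (join_endo M).

Lemma join_endoP f g : f =1 g -> f = g.
Proof.
case: f g => [f f0 fU] [g g0 gU] /= /funext fgE; subst g.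
by congr JoinEndo; exact: Prop_irrelevance.
Qed.

Lemma endo0_join : {morph (fun _ : M => \bot%O : M) : x y / (x `|` y)%O}.
Proof. by move=> x y; rewrite joinxx. Qed.

Lemma endoD_bot f g : (f \bot `|` g \bot = \bot)%O.
Proof. by rewrite !join_endo0 joinxx. Qed.

Lemma endoD_join f g : {morph (fun x : M => (f x `|` g x)%O) : x y / (x `|` y)%O}.
Proof. by move=> x y; rewrite !join_endoU joinACA. Qed.

Lemma endoM_bot f g : f (g \bot%O) = \bot%O.
Proof. by rewrite !join_endo0. Qed.

Lemma endoM_join f g : {morph (fun x : M => f (g x)) : x y / (x `|` y)%O}.
Proof. by move=> x y; rewrite !join_endoU. Qed.

Definition endo0 := JoinEndo erefl endo0_join.
Definition endo1 := @JoinEndo d M id erefl (fun _ _ => erefl).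
Definition endoD f g := JoinEndo (endoD_bot f g) (endoD_join f g).
Definition endoM f g := JoinEndo (endoM_bot f g) (endoM_join f g).

Lemma endoDA : associative endoD.
Proof. by move=> f g h; apply: join_endoP => x /=; exact: joinA. Qed.

Lemma endoDC : commutative endoD.
Proof. by move=> f g; apply: join_endoP => x /=; exact: joinC. Qed.

Lemma endo0D : left_id endo0 endoD.
Proof. by move=> f; apply: join_endoP => x /=; exact: join0x. Qed.

HB.instance Definition _ :=
  GRing.isNmodule.Build (join_endo M) endoDA endoDC endo0D.

Lemma endoMA : associative endoM.
Proof. by move=> f g h; apply: join_endoP. Qed.

Lemma endo1M : left_id endo1 endoM.
Proof. by move=> f; apply: join_endoP. Qed.

Lemma endoM1 : right_id endo1 endoM.
Proof. by move=> f; apply: join_endoP. Qed.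

Lemma endoMDl : left_distributive endoM +%R.
Proof. by move=> f g h; apply: join_endoP. Qed.

Lemma endoMDr : right_distributive endoM +%R.
Proof. by move=> f g h; apply: join_endoP => x /=; exact: join_endoU. Qed.

Lemma endo0M : left_zero 0 endoM.
Proof. by move=> f; apply: join_endoP. Qed.

Lemma endoM0 : right_zero 0 endoM.
Proof. by move=> f; apply: join_endoP => x /=; exact: join_endo0. Qed.

HB.instance Definition _ :=
  GRing.Nmodule_isPzSemiRing.Build (join_endo M)
    endoMA endo1M endoM1 endoMDl endoMDr endo0M endoM0.

End JoinEndo.

Definition isomorphic (R S : pzSemiRingType) : Prop :=
  exists f : {rmorphism R -> S}, bijective f.

(* A [unitRingType] is nonzero, so this makes it a (possibly noncommutative)
   division ring. *)
Definition division_ring (F : unitRingType) : Prop :=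
  forall x : F, x != 0 -> x \is a GRing.unit.

(* Main.v *)
Require Import Defs.
From HB Require Import structures.
From mathcomp Require Import all_boot all_order all_algebra.
From mathcomp Require Import boolp classical_sets cardinality.

Set Implicit Arguments.
Unset Strict Implicit.
Unset Printing Implicit Defensive.

Import Order.TTheory GRing.Theory.
Local Open Scope ring_scope.

(* Both one-sided conditions amount to the same symmetric one: R is simple and
   has an idempotent e <> 0 such that every nonzero element of e R e is
   invertible there.  Indeed, lifting the identity of a projective minimal
   left ideal R x along r |-> r x produces an idempotent e with R e isomorphic
   to R x, and conversely R e is then projective and minimal.

   Ideal-simplicity gives 1 = sum_i u_i e v_i.  The additively invertible
   elements form an ideal.  If they are all of R, then R is a ring; taking the
   sum as short as possible forces e v_i u_j e = delta_ij e, so that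
   r |-> (e v_i r u_j e)_ij is an isomorphism onto the matrices over e R e.  If
   only 0 is additively invertible, then congruence-simplicity forces
   e R e = {0, e} and 1 + 1 = 1; the u_i e and e v_i are then dual generators
   that make R e a finite distributive lattice and R its endomorphism semiring.

   In the other direction, an expansion 1 = sum_i u_i e v_i reduces the
   simplicity of R to that of e R e.  In E_M it is the decomposition of the
   identity into maps x |-> (0 if x <= a, else c), which exists because M is
   distributive. *)

(** * Division idempotents and projective minimal ideals *)

(** The inverse [y] is sought in all of [R]; [e * y * e] is then an inverse inside e R e. *)
Record division_idempotent (R : pzSemiRingType) (e : R) : Prop :=
  DivisionIdempotent {
    divi_idem : e * e = e;
    divi_neq0 : e <> 0;
    divi_inv : forall x, e * x * e <> 0 ->
      exists y, y * (e * x * e) = e /\ e * x * e * y = e }.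

Lemma converse_division_idempotent (R : pzSemiRingType) (e : R) :
  division_idempotent (e : R^c) <-> division_idempotent e.
Proof.
split=> -[ee e0 inv]; split=> // x.
  rewrite -mulrA => exe0; have [y [yl yr]] := inv x exe0.
  by exists y; split; [exact: yr | exact: yl].
have inv' (z : R) : e * (z * e) <> 0 ->
    exists y, e * (z * e) * y = e /\ y * (e * (z * e)) = e.
  by rewrite mulrA => /inv[y [yl yr]]; exists y.
exact: inv'.
Qed.

Lemma converse_simple (R : pzSemiRingType) :
  simple_semiring R -> simple_semiring R^c.
Proof.
case=> iR cR; split.
  move=> I [[I0 ID IMl] [_ _ IMr]]; apply: (iR I); split; split=> //.
move=> c [cr cs ct cD cM]; apply: (cR c); split=> // x x' y y' xx' yy'.
exact: (cM _ _ _ _ yy' xx').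
Qed.

Lemma projective_minimal_right_ideal_converse (R : pzSemiRingType) :
  has_projective_minimal_right_ideal R <->
  has_projective_minimal_left_ideal R^c.
Proof.
have toR (J : set R) : left_ideal (J : set R^c) -> right_ideal J.
  by case=> J0 JD JM; split=> // r x Jx; exact: (JM r x Jx).
split=> [[I [idI [[_ I0 minI] prI]]]|[I [idI [[_ I0 minI] prI]]]].
  exists I, (right_ideal_converse idI); split=> //.
  split=> [||J /toR]; [exact: right_ideal_converse|by []|exact: minI].
exists I, (toR _ idI); split; last first.
  (* The semimodule type depends on the proof that [I] is an ideal, so the two proofs have to be
     identified. *)
  by rewrite (Prop_irrelevance (right_ideal_converse (toR _ idI)) idI).
split=> [||J /right_ideal_converse]; [exact: toR|by []|exact: minI].
Qed.

Section ProjectiveMinimal.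
Variables (R : pzSemiRingType) (e : R).
Hypothesis ee : e * e = e.

(** This is R e, because [e] is idempotent. *)
Definition principal_left_ideal : set R := [set x | x * e = x]%classic.

Lemma principal_left_idealP : left_ideal principal_left_ideal.
Proof.
split=> [|x y /= xe ye|r x /= xe]; rewrite /principal_left_ideal /=.
- exact: mul0r.
- by rewrite mulrDl xe ye.
- by rewrite -mulrA xe.
Qed.

Local Notation P := (ideal_semimod principal_left_idealP).

Lemma unit_finite (f : unit -> R) : finite_set [set i | f i <> 0]%classic.
Proof. exact: finite_finset. Qed.

Definition principal_incl (x : P) : free_semimod R unit :=
  FreeSemimod (unit_finite (fun=> \val x : R)).

Lemma principal_proj_subproof (f : free_semimod R unit) :
  (f tt * e : R^o) \in (principal_left_ideal : set R^o).
Proof. by rewrite inE /principal_left_ideal /= -mulrA ee. Qed.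

Definition principal_proj (f : free_semimod R unit) : P :=
  exist (fun x : R^o => x \in (principal_left_ideal : set R^o)) _
    (principal_proj_subproof f).

Lemma principal_incl_linear : semilinear principal_incl.
Proof. by split=> [r x|x y]; apply: free_semimodP. Qed.

Lemma principal_proj_linear : semilinear principal_proj.
Proof.
split=> [r x|x y]; apply: val_inj => /=; first by rewrite -mulrA.
by rewrite mulrDl.
Qed.

HB.instance Definition _ :=
  GRing.isSemilinear.Build R P (free_semimod R unit) _ principal_incl
    principal_incl_linear.
HB.instance Definition _ :=
  GRing.isSemilinear.Build R (free_semimod R unit) P _ principal_proj
    principal_proj_linear.

(** Right multiplication by [e] retracts R, the free semimodule on the single index [tt], onto R
    e. *)
Lemma principal_projective : projective P.
Proof.
exists unit, principal_incl, principal_proj => x; apply: val_inj => /=.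
by have := valP x; rewrite inE.
Qed.

End ProjectiveMinimal.

(** The elements killed by all x |-> e a x b e form an ideal [A] that misses [e], so [A] is 0. A
    nonzero y in R e thus has some e a y e <> 0, and inverting it puts [e], hence R e, inside R
    y. *)
Lemma projective_minimal_left_ideal_of_idempotent (R : pzSemiRingType) (e : R) :
  ideal_simple R -> division_idempotent e ->
  has_projective_minimal_left_ideal R.
Proof.
move=> iR [ee e0 inv].
exists (principal_left_ideal e), (principal_left_idealP e).
split; last exact: principal_projective.
split; first exact: principal_left_idealP.
  by move=> I0; apply: e0; have : principal_left_ideal e e by []; rewrite I0.
pose A := [set x : R | forall a b, e * (a * x * b) * e = 0]%classic.
have A0 x : A x -> x = 0.
  have idA : ideal A.
    have A0 : A 0 by move=> a b; rewrite mulr0 mul0r mulr0 mul0r.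
    have AD u v : A u -> A v -> A (u + v).
      by move=> Au Av a b; rewrite mulrDr !mulrDl mulrDr mulrDl Au Av addr0.
    split; split=> // r u Au a b.
      by rewrite (mulrA a); exact: Au.
    by rewrite (mulrA a) -(mulrA _ r); exact: Au.
  have [-> //|AT] := iR _ idA.
  have /(_ 1 1) : A e by rewrite AT.
  by rewrite mul1r mulr1 ee ee.
move=> J [J0 JD JM] Jneq0 JP; apply/seteqP; split=> // x xe.
have [y Jy y0] : exists2 y, J y & y <> 0.
  apply: contrapT => nJ; apply: Jneq0; apply/seteqP; split=> y /=;
    last by move->.
  by move=> Jy; apply: contrapT => y0; apply: nJ; exists y.
have [a [b eayb]] : exists a b, e * (a * y * b) * e <> 0.
  apply: contrapT => nab; apply: y0; apply: A0 => a b.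
  by apply: contrapT => eayb; apply: nab; exists a, b.
have ye : y * e = y by exact: JP.
(* As y = y e, the factor [b] splits off: e a y b e = (e a y e)(b e). *)
have eay : e * (a * y) * e <> 0.
  move=> eay; apply: eayb; rewrite -ye.
  have -> : e * (a * (y * e) * b) * e = e * (a * y) * e * (b * e).
    by rewrite !mulrA.
  by rewrite eay mul0r.
have [z [ze _]] := inv _ eay.
suff -> : x = x * z * e * a * y by exact: JM.
by rewrite -[LHS]xe -[X in x * X = _]ze -(mulrA e) -(mulrA a) ye !mulrA.
Qed.


Lemma division_idempotent_of_left_inverses (R : pzSemiRingType) (e : R) :
    e * e = e -> e <> 0 ->
    (forall a, a * e <> 0 -> exists b, b * (a * e) = e) ->
  division_idempotent e.
Proof.
move=> ee e0 inv; split=> // x x0.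
have [y yx] := inv _ x0.
have eK u : e * (e * u * e) = e * u * e by rewrite !mulrA ee.
have y'x : e * y * e * (e * x * e) = e.
  by rewrite -(mulrA _ e) eK -(mulrA e y) yx ee.
have [z zy] : exists z, z * (e * y * e) = e.
  by apply: inv => y0; apply: e0; rewrite -y'x y0 mul0r.
exists (e * y * e); split=> //.
suff -> : e * x * e = z * e by rewrite -mulrA eK zy.
(* As in a group, [z] is a left inverse of the left inverse e y e, so z e = e x e and the left
   inverse is two-sided. *)
by rewrite -[in RHS]y'x mulrA zy eK.
Qed.

Section DualBasis.
Variables (R : pzSemiRingType) (J : Type).

Lemma free_delta_finite (j : {classic J}) :
  finite_set [set i : J | (((i : {classic J}) == j)%:R : R) <> 0]%classic.
Proof.
apply: sub_finite_set (finite_set1 (j : J)) => i /=.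
by case: eqP => // _; rewrite mulr0n.
Qed.

(** [{classic J}] supplies the decidable equality that an arbitrary index type lacks. *)
Definition free_delta (j : {classic J}) : free_semimod R J :=
  FreeSemimod (free_delta_finite j).

Lemma free_coef_sum (s : seq {classic J})
    (F : {classic J} -> free_semimod R J) i :
  (\sum_(j <- s) F j) i = \sum_(j <- s) F j i.
Proof. by elim: s => [|j s IH]; rewrite ?big_nil // !big_cons -IH. Qed.

Lemma free_deltaE (f : free_semimod R J) (s : seq {classic J}) :
    uniq s -> (forall j, f j <> 0 -> j \in s) ->
  f = \sum_(j <- s) f j *: free_delta j.
Proof.
move=> us fs; apply: free_semimodP => i; rewrite free_coef_sum //.
have [si|/negP si] := boolP ((i : {classic J}) \in s); last first.
  have -> : f i = 0 by apply: contrapT => /fs.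
  rewrite big1_seq // => j /andP[_ js] /=; case: eqP => [ij|_];
    rewrite ?mulr0 //.
  by case: si; rewrite ij.
rewrite (bigD1_seq (i : {classic J})) //= eqxx mulr1 big1 ?addr0 // => j.
by rewrite eq_sym => /negbTE ->; rewrite mulr0.
Qed.

End DualBasis.

Lemma division_idempotent_of_projective (R : pzSemiRingType) :
  has_projective_minimal_left_ideal R -> exists e : R, division_idempotent e.
Proof.
case=> I [idI [[_ I0 minI] [J [s [p sK]]]]].
set P := ideal_semimod idI in s p sK.
(* By minimality R x is the whole ideal for every nonzero x in it. *)
have gen (x y : P) : x <> 0 -> exists r, r *: x = y.
  move=> x0; pose K := [set \val (r *: x) | r in [set: R]]%classic.
  have KI : K = I :> set R.
    apply: minI.
    - split; first by exists 0 => //; rewrite scale0r.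
        by move=> _ _ [r _ <-] [t _ <-]; exists (r + t) => //; rewrite scalerDl.
      by move=> r _ [t _ <-]; exists (r * t) => //; rewrite -scalerA.
    - move=> K0; apply: x0; apply: val_inj.
      have : K (\val (1 *: x)) by exists 1.
      by rewrite K0 /= scale1r.
    - by move=> _ [r _ <-]; have := valP (r *: x); rewrite inE.
  have : K (\val y) by rewrite KI; have := valP y; rewrite inE.
  by case=> r _ /val_inj <-; exists r.
have [x x0] : exists x : P, x <> 0.
  apply: contrapT => nx; apply: I0; apply/seteqP; split=> y /=; last first.
    by move=> ->; exact: left_ideal0.
  move=> Iy; have Py : (y : R^o) \in (I : set R^o) by rewrite inE.
  apply: contrapT => y0; apply: nx.
  by exists (exist (fun x : R^o => x \in (I : set R^o)) _ Py) => /(congr1 \val).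
have /choice[c cE] (j : {classic J}) : exists r, r *: x = p (free_delta R j).
  exact: gen.
have [S SE] := (finite_seqP _).1
  (free_coef_finite (s x : free_semimod R {classic J})).
have supp (j : {classic J}) : s x j <> 0 -> j \in undup S.
  by rewrite mem_undup => sxj; suff : [set` S]%classic j by []; rewrite -SE.
(* [g] lifts the identity of [P] along r |-> r x: it sends basis vector j to some [c j] with c_j x =
   p(delta_j). Summing over the support of [s x] is enough, since every element of [P] is a multiple
   of x. *)
pose g y := \sum_(j <- undup S) s y j * c j.
have gZ r y : g (r *: y) = r * g y.
  by rewrite /g mulr_sumr; apply: eq_bigr => j _; rewrite linearZ /= mulrA.
have gx : g x *: x = x.
  rewrite -[RHS]sK [X in p X](@free_deltaE _ _ _ (undup S)) ?undup_uniq //.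
    rewrite linear_sum scaler_suml; apply: eq_bigr => j _.
    by rewrite linearZ /= -cE scalerA.
(* Linearity gives g(x) g(x) = g(g(x) x) = g(x), and b a x = x gives b a g(x) = g(x). *)
exists (g x); apply: division_idempotent_of_left_inverses.
- by rewrite -gZ gx.
- by move=> gx0; apply: x0; rewrite -gx gx0 scale0r.
- move=> a; rewrite -gZ => gax.
  have [|b bax] := gen (a *: x) x.
    by move=> ax; apply: gax; rewrite ax -(scale0r x) gZ mul0r.
  by exists b; rewrite -gZ bax.
Qed.

(** * The zerosumfree case *)

(** The finite sums of products r e s form an ideal containing [e], so it contains 1. *)
Lemma full_idempotent (R : pzSemiRingType) (e : R) :
    ideal_simple R -> e * e = e -> e <> 0 ->
  exists n (u v : 'I_n -> R), 1 = \sum_(i < n) u i * e * v i.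
Proof.
move=> iR ee e0.
pose K := [set x : R | exists s : seq (R * R),
  x = \sum_(p <- s) p.1 * e * p.2]%classic.
have KD x y : K x -> K y -> K (x + y).
  by move=> [s ->] [t ->]; exists (s ++ t); rewrite big_cat.
have idK : ideal K.
  have K0 : K 0 by exists [::]; rewrite big_nil.
  split; split=> // r x [s ->].
    exists [seq (r * p.1, p.2) | p <- s]; rewrite big_map mulr_sumr.
    by apply: eq_bigr => p _; rewrite /= !mulrA.
  exists [seq (p.1, p.2 * r) | p <- s]; rewrite big_map mulr_suml.
  by apply: eq_bigr => p _; rewrite /= !mulrA.
have Ke : K e by exists [:: (1, e)]; rewrite big_seq1 /= mul1r ee.
have [K0|KT] := iR _ idK; first by case: e0; rewrite K0 in Ke.
have [s sE] : K 1 by rewrite KT.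
exists (size s), (fun i => (nth (0, 0) s i).1), (fun i => (nth (0, 0) s i).2).
by rewrite [LHS]sE (big_nth (0, 0)) big_mkord.
Qed.

(* [u i * e] and [e * v i] are dual generating families of [R e] and [e R] for
   the pairing with values in the Boolean semifield [e R e = {0, e}]. *)
Record boolean_frame (R : pzSemiRingType) (n : nat) (e : R) (u v : 'I_n -> R)
    : Prop := BooleanFrame {
  frame_idem : e * e = e;
  frame_neq0 : e <> 0;
  frame_addxx : forall x : R, x + x = x;
  frame_corner : forall x, e * x * e = 0 \/ e * x * e = e;
  frame_sum : 1 = \sum_(i < n) u i * e * v i }.

Lemma zerosumfree_boolean_frame (R : pzSemiRingType) (e : R) :
    simple_semiring R -> division_idempotent e ->
    (forall x y : R, x + y = 0 -> x = 0) ->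
  exists n (u v : 'I_n -> R), boolean_frame e u v.
Proof.
move=> [iR cR] [ee e0 inv] zsf.
have [n [u [v uv]]] := full_idempotent iR ee e0.
(* This makes the relation [c] below additive, and lets it identify x + x with x. *)
have addr_eq0 (x y : R) : x + y = 0 <-> x = 0 /\ y = 0.
  split=> [xy|[-> ->]]; last exact: addr0.
  by split; [exact: zsf xy|apply: (zsf y x); rewrite addrC].
(* This congruence separates [e] from [0], so it is trivial; but it identifies
   [x] with [x + x], and, as [e R e] has no zero divisors, every
   [e x e <> 0] with [e]. *)
pose c (r s : R) :=
  forall a b, e * (a * r * b) * e = 0 <-> e * (a * s * b) * e = 0.
have cE r s : c r s -> r = s.
  have cc : congruence c.
    split=> [x a b|x y xy a b|x y z xy yz a b|x x' y y' xx' yy' a b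
            |x x' y y' xx' yy' a b] //.
    - exact: iff_sym.
    - exact: iff_trans (xy a b) (yz a b).
    - have [[xx1 xx2] [yy1 yy2]] := (xx' a b, yy' a b).
      rewrite !(mulrDr, mulrDl) !addr_eq0.
      by split=> -[x0 y0]; split; auto.
    - apply: (@iff_trans _ (e * (a * (x' * y) * b) * e = 0)).
        by have := xx' a (y * b); rewrite !mulrA.
      by have := yy' (a * x') b; rewrite !mulrA.
  have [cE|cT] := cR c cc; first by move/cE.
  case: e0; have [_ /(_ _)] := cT e 0 1 1.
  by rewrite mulr0 mul0r mulr0 mul0r mul1r mulr1 !ee; apply.
exists n, u, v; split=> // x.
  by apply: cE => a b; rewrite !(mulrDr, mulrDl) addr_eq0; split=> [[]|].
have [->|x0] := pselect (e * x * e = 0); [by left|right].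
apply: cE => a b; have [y [yx xy]] := inv _ x0.
have nzd w z : e * w * e * (e * z * e) = 0 -> e * w * e = 0 \/ e * z * e = 0.
  move=> wz; have [|w0] := pselect (e * w * e = 0); [by left|right].
  have [t [tw _]] := inv _ w0.
  have -> : e * z * e = t * (e * w * e * (e * z * e)).
    by rewrite mulrA tw !mulrA ee.
  by rewrite wz mulr0.
have E1 : e * (a * e * b) * e = e * a * e * (e * b * e).
  by rewrite -!mulrA (mulrA e e) ee.
have E2 : e * (a * (e * x * e) * b) * e = e * a * e * (e * (x * e * b) * e).
  by rewrite -!mulrA (mulrA e e) ee.
split=> [|ab0].
  rewrite E2 => /nzd[a0|]; first by rewrite E1 a0 mul0r.
  have -> : e * (x * e * b) * e = e * x * e * (e * b * e).
    by rewrite -!mulrA (mulrA e e) ee.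
  by move=> /nzd[//|b0]; rewrite E1 b0 mulr0.
rewrite E1 in ab0; have [a0|b0] := nzd _ _ ab0.
  by rewrite E2 a0 mul0r.
have -> : e * (a * (e * x * e) * b) * e = e * a * e * x * (e * b * e).
  by rewrite !mulrA.
by rewrite b0 mulr0.
Qed.

(** * The finite distributive lattice R e and the action of R on it *)

Section FrameLattice.
Variables (R : pzSemiRingType) (n : nat) (e : R) (u v : 'I_n -> R).
Hypothesis uv : boolean_frame e u v.

(* The argument [uv] is used only to attach the lattice structure. *)
Definition frame_lattice of boolean_frame e u v := {q : R | q * e == q}.
Local Notation Q := (frame_lattice uv).

HB.instance Definition _ := SubChoice.on Q.

Lemma frame_fixed (q : Q) : \val q * e = \val q.
Proof. exact/eqP/(valP q). Qed.

Lemma frame_pairing i (q : Q) : e * v i * \val q = 0 \/ e * v i * \val q = e.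
Proof. by rewrite -frame_fixed mulrA -(mulrA e); exact: frame_corner uv _. Qed.

Lemma frame_expand (x : R) : x = \sum_(i < n) u i * (e * v i * x).
Proof.
rewrite -[LHS]mul1r (frame_sum uv) mulr_suml.
by apply: eq_bigr => i _; rewrite !mulrA.
Qed.

Lemma frame_sum_fixed (I : Type) (s : seq I) (A : pred I) (F : I -> R) :
  (forall i, A i -> F i * e == F i) ->
  (\sum_(i <- s | A i) F i) * e == \sum_(i <- s | A i) F i.
Proof.
by move=> FA; rewrite mulr_suml; apply/eqP/eq_bigr => i /FA/eqP.
Qed.

Definition frame_coords (q : Q) : {set 'I_n} := [set i | e * v i * \val q == e].

Lemma frame_span_subproof (A : {set 'I_n}) :
  (\sum_(i in A) u i * e) * e == \sum_(i in A) u i * e.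
Proof.
by apply: frame_sum_fixed => i _; rewrite -mulrA (frame_idem uv).
Qed.

Definition frame_span (A : {set 'I_n}) : Q :=
  exist (fun q => q * e == q) _ (frame_span_subproof A).

(** In q = sum_i u_i (e v_i q) each pairing is 0 or [e], so the set of indices with pairing [e]
    determines q. Hence R e is finite. *)
Lemma frame_coordsK : cancel frame_coords frame_span.
Proof.
move=> q; apply: val_inj => /=; rewrite [RHS]frame_expand big_mkcond /=.
apply: eq_bigr => i _; rewrite inE.
have [->|->] := frame_pairing i q; last by rewrite eqxx.
by case: eqP => [e0|_]; rewrite mulr0 // -e0 mulr0.
Qed.

HB.instance Definition _ : isCountable Q := CanIsCountable frame_coordsK.
HB.instance Definition _ : isFinite Q := CanIsFinite frame_coordsK.

Definition frame_le (q r : Q) := \val q + \val r == \val r.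

Lemma frame_le_refl : reflexive frame_le.
Proof. by move=> q; rewrite /frame_le (frame_addxx uv). Qed.

Lemma frame_le_anti : antisymmetric frame_le.
Proof.
move=> q r /andP[/eqP qr /eqP rq]; apply: val_inj.
by rewrite -qr -[LHS]rq addrC.
Qed.

Lemma frame_le_trans : transitive frame_le.
Proof. by move=> r q t /eqP qr /eqP rt; rewrite /frame_le -rt addrA qr. Qed.

HB.instance Definition _ := Order.Le_isPOrder.Build (Order.Disp tt tt) Q
  frame_le_refl frame_le_anti frame_le_trans.

Lemma frame_leP (q r : Q) : reflect (\val q + \val r = \val r) (q <= r)%O.
Proof. exact: eqP. Qed.

Lemma frame_sum_le (I : Type) (s : seq I) (A : pred I) (F : I -> R) (z : R) :
    (forall i, A i -> F i + z = z) ->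
  (\sum_(i <- s | A i) F i) + z = z.
Proof.
move=> Fz; elim: s => [|i s IH]; first by rewrite big_nil add0r.
by rewrite big_cons; case: ifP => [Ai|//]; rewrite -addrA IH Fz.
Qed.

Lemma frame_join_subproof (q r : Q) : (\val q + \val r) * e == \val q + \val r.
Proof. by rewrite mulrDl !frame_fixed. Qed.

Definition frame_join (q r : Q) : Q :=
  exist (fun q => q * e == q) _ (frame_join_subproof q r).

Lemma frame_joinP (q r t : Q) :
  (frame_join q r <= t)%O = (q <= t)%O && (r <= t)%O.
Proof.
apply/frame_leP/andP => /= [qrt|[/frame_leP qt /frame_leP rt]]; last first.
  by rewrite -addrA rt.
split; apply/frame_leP; rewrite /= -qrt.
  by rewrite !addrA (frame_addxx uv (sval q)).
by rewrite (addrC (sval q)) !addrA (frame_addxx uv (sval r)).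
Qed.

Lemma frame_meet_subproof (q r : Q) :
  (\sum_(t : Q | (t <= q)%O && (t <= r)%O) \val t) * e ==
  \sum_(t : Q | (t <= q)%O && (t <= r)%O) \val t.
Proof. by apply: frame_sum_fixed => t _; apply/eqP; exact: frame_fixed. Qed.

(** In a finite join-semilattice with 0, the sum of all common lower bounds is the greatest one. *)
Definition frame_meet (q r : Q) : Q :=
  exist (fun q => q * e == q) _ (frame_meet_subproof q r).

Lemma frame_meetP (t q r : Q) :
  (t <= frame_meet q r)%O = (t <= q)%O && (t <= r)%O.
Proof.
have [lq lr] : (frame_meet q r <= q)%O /\ (frame_meet q r <= r)%O.
  split; apply/frame_leP/frame_sum_le => s.
    by move=> /andP[/frame_leP sq _].
  by move=> /andP[_ /frame_leP sr].
apply/idP/andP => [tqr|tqr]; first by split; exact: le_trans tqr _.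
apply/frame_leP => /=; rewrite (bigD1 t) /=; last exact/andP.
by rewrite addrA (frame_addxx uv).
Qed.

HB.instance Definition _ := Order.POrder_MeetJoin_isLattice.Build _ Q
  frame_meetP frame_joinP.

(** The pairing is additive with values in {0, e}: if it vanishes on one summand, the other carries
    the value [e]. *)
Lemma frame_join_prime i (x y : Q) :
    e * v i * \val (x `|` y)%O = e ->
  e * v i * \val x = e \/ e * v i * \val y = e.
Proof.
rewrite /= mulrDr => xy; have [x0|] := frame_pairing i x; last by left.
by right; rewrite -[RHS]xy x0 add0r.
Qed.

(** Here [u i * e] is one of the terms in the expansion of x, and addition is idempotent. *)
Lemma frame_generator_le i (x : Q) :
  e * v i * \val x = e -> u i * e + \val x = \val x.
Proof.
move=> xi; have [y xE] : exists y, \val x = u i * e + y.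
  by rewrite [\val x]frame_expand (bigD1 i) //= xi; eexists.
by rewrite xE addrA (frame_addxx uv (u i * e)).
Qed.

Lemma frame_le_generators (x y : Q) :
  (forall i, e * v i * \val x = e -> u i * e + \val y = \val y) -> (x <= y)%O.
Proof.
move=> xy; apply/frame_leP; rewrite (frame_expand (\val x)).
apply: frame_sum_le => i _; have [->|xi] := frame_pairing i x.
  by rewrite mulr0 add0r.
by rewrite xi; exact: xy.
Qed.

Lemma frame_coord_le i (x y : Q) :
  (x <= y)%O -> e * v i * \val x = e -> e * v i * \val y = e.
Proof.
move=> /frame_leP xy xi; have [y0|//] := frame_pairing i y.
by have := congr1 (fun t => e * v i * t) xy; rewrite mulrDr xi y0 addr0.
Qed.

(** Only the inequality from left to right is special to this lattice, and it can be tested on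
    generators. If coordinate i of the left side is [e], primeness gives it to x or to y, so u_i e
    lies below the meet of that element with z. *)
Lemma frame_meetUl : left_distributive (@Order.meet _ Q) (@Order.join _ Q).
Proof.
move=> x y z; apply/le_anti/andP; split; last first.
  by rewrite leUx !lexI !leIr !andbT (le_trans (leIl x z)) ?leUl //
    (le_trans (leIl y z)) ?leUr.
apply: frame_le_generators => i wi.
have zi := frame_coord_le (leIr _ _) wi.
pose g := frame_span [set i].
have gE : \val g = u i * e by rewrite /= big_set1.
have gle t : e * v i * \val t = e -> (g <= t)%O.
  by move=> ti; apply/frame_leP; rewrite gE; exact: frame_generator_le.
rewrite -gE; apply/frame_leP.
have /frame_join_prime[xi|yi] := frame_coord_le (leIl _ _) wi.
  by apply: le_trans (leUl _ _); rewrite lexI !gle.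
by apply: le_trans (leUr _ _); rewrite lexI !gle.
Qed.

HB.instance Definition _ := Order.Lattice_Meet_isDistrLattice.Build _ Q
  frame_meetUl.

Lemma frame_bot_subproof : 0 * e == 0.
Proof. by rewrite mul0r. Qed.

Definition frame_bot : Q := exist (fun q => q * e == q) _ frame_bot_subproof.

Lemma frame_le0x (q : Q) : (frame_bot <= q)%O.
Proof. by apply/frame_leP; rewrite /= add0r. Qed.

HB.instance Definition _ := Order.hasBottom.Build _ Q frame_le0x.

Lemma frame_lex1 (q : Q) : (q <= \join_(r : Q) r)%O.
Proof. exact: joins_sup. Qed.

HB.instance Definition _ := Order.hasTop.Build _ Q frame_lex1.

(** The default [frame_bot] is never reached, since r q stays in R e. *)
Definition frame_action_fun (r : R) (q : Q) : Q :=
  insubd frame_bot (r * \val q).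

Lemma frame_actionE r (q : Q) : \val (frame_action_fun r q) = r * \val q.
Proof. by rewrite insubdK // -topredE /= -mulrA frame_fixed. Qed.

Lemma frame_action0 r : frame_action_fun r \bot%O = \bot%O.
Proof. by apply: val_inj; rewrite frame_actionE /= mulr0. Qed.

Lemma frame_actionU r : {morph frame_action_fun r : x y / (x `|` y)%O}.
Proof.
move=> x y; apply: val_inj; rewrite frame_actionE /= mulrDr.
by rewrite -!frame_actionE.
Qed.

Definition frame_action (r : R) : join_endo Q :=
  JoinEndo (frame_action0 r) (@frame_actionU r).

Lemma frame_action_nmod : nmod_morphism frame_action.
Proof.
split=> [|r s]; apply: join_endoP => q; apply: val_inj.
  by rewrite frame_actionE mul0r.
by rewrite /= !frame_actionE mulrDl.
Qed.

Lemma frame_action_monoid : GRing.monoid_morphism frame_action.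
Proof.
split=> [|r s]; apply: join_endoP => q; apply: val_inj.
  by rewrite frame_actionE mul1r.
by rewrite /= !frame_actionE mulrA.
Qed.

HB.instance Definition _ :=
  GRing.isNmodMorphism.Build R (join_endo Q) frame_action frame_action_nmod.
HB.instance Definition _ :=
  GRing.isMonoidMorphism.Build R (join_endo Q) frame_action frame_action_monoid.

Definition frame_generator i : Q := frame_span [set i].

Definition frame_action_inv (f : join_endo Q) : R :=
  \sum_(i < n) \val (f (frame_generator i)) * (e * v i).

(** This is the dual-basis argument. One composite is r = sum_i (r u_i e)(e v_i); for the other, q
    is the join of the generators at its coordinates, so f(q) = sum_i f(u_i e)(e v_i q). *)
Lemma frame_action_bij : bijective frame_action.
Proof.
exists frame_action_inv => [r|f].
  rewrite /frame_action_inv -[RHS]mulr1 [in RHS](frame_sum uv) mulr_sumr.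
  apply: eq_bigr => i _.
  by rewrite frame_actionE /= big_set1 -!mulrA (mulrA e e) (frame_idem uv).
apply: join_endoP => q; apply: val_inj; rewrite frame_actionE mulr_suml.
have fE (A : {set 'I_n}) :
    \val (f (\join_(i in A) frame_generator i)%O)
    = \sum_(i in A) \val (f (frame_generator i)).
  elim/big_rec2: _ => [|i x y _ <-]; first by rewrite join_endo0.
  by rewrite join_endoU.
have qE : q = (\join_(i in frame_coords q) frame_generator i)%O.
  rewrite -[LHS]frame_coordsK; apply: val_inj => /=.
  elim/big_rec2: _ => [|i x y _ ->] //=.
  by rewrite big_set1.
rewrite [in RHS]qE fE [RHS]big_mkcond; apply: eq_bigr => i _ /=.
rewrite inE -mulrA; have [->|->] := frame_pairing i q.
  by case: eqP => [e0|_]; rewrite mulr0 //; case: (frame_neq0 uv).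
by rewrite eqxx; exact: frame_fixed.
Qed.
End FrameLattice.

(** * The ring case *)

(** An equality of structures, rather than an isomorphism, lets all hypotheses on [R] pass to the
    ring by substitution. *)
Lemma semiring_with_opposite (R : pzSemiRingType) :
  (forall x : R, exists y, x + y = 0) ->
  exists R' : pzRingType, R = R' :> pzSemiRingType.
Proof.
case: R => T [? ? ? ? ? ? ? ?].
set R := GRing.PzSemiRing.Pack _ => /choice[opp oppE].
have addNr : left_inverse 0 opp +%R by move=> x; rewrite addrC oppE.
pose Z := GRing.Nmodule_isZmodule.Build R addNr.
pose R' : pzRingType := HB.pack T (GRing.PzSemiRing.class R) Z.
by exists R'.
Qed.

(** * The division ring e R e and matrices over it *)

Section Corner.
Variables (R : pzRingType) (e : R).
Hypothesis de : division_idempotent e.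

(* The argument [de] is used only to attach the division ring structure. *)
Definition corner of division_idempotent e := {x : R | e * x * e == x}.
Local Notation D := (corner de).

HB.instance Definition _ := SubChoice.on D.

Lemma corner_closed : zmod_closed (fun x : R => e * x * e == x).
Proof.
split=> [|x y]; rewrite -!topredE /= ?mulr0 ?mul0r // => /eqP xe /eqP ye.
by rewrite mulrBr mulrBl xe ye.
Qed.

HB.instance Definition _ :=
  GRing.SubChoice_isSubZmodule.Build R (fun x : R => e * x * e == x) D
    corner_closed.

Lemma cornerP (x : D) : e * \val x * e = \val x.
Proof. exact/eqP/(valP x). Qed.

Lemma corner_mem (x : R) : e * (e * x * e) * e == e * x * e.
Proof. by rewrite !mulrA (divi_idem de) -mulrA (divi_idem de). Qed.

Definition to_corner (x : R) : D :=
  exist (fun x => e * x * e == x) _ (corner_mem x).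

Lemma corner_mull (x : D) : e * \val x = \val x.
Proof. by rewrite -cornerP !mulrA (divi_idem de). Qed.

Lemma corner_mulr (x : D) : \val x * e = \val x.
Proof. by rewrite -cornerP -mulrA (divi_idem de). Qed.

Definition corner_one : D := to_corner 1.
Definition corner_mul (x y : D) : D := to_corner (\val x * \val y).

Lemma corner_oneE : \val corner_one = e.
Proof. by rewrite /= mulr1 (divi_idem de). Qed.

Lemma corner_mulE x y : \val (corner_mul x y) = \val x * \val y.
Proof. by rewrite /= mulrA corner_mull -mulrA corner_mulr. Qed.

Lemma corner_valD (x y : D) : \val (x + y) = \val x + \val y.
Proof. by []. Qed.

Lemma corner_mulA : associative corner_mul.
Proof. by move=> x y z; apply: val_inj; rewrite !corner_mulE mulrA. Qed.

Lemma corner_mul1r : left_id corner_one corner_mul.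
Proof.
by move=> x; apply: val_inj; rewrite corner_mulE corner_oneE corner_mull.
Qed.

Lemma corner_mulr1 : right_id corner_one corner_mul.
Proof.
by move=> x; apply: val_inj; rewrite corner_mulE corner_oneE corner_mulr.
Qed.

Lemma corner_mulDl : left_distributive corner_mul +%R.
Proof.
by move=> x y z; apply: val_inj; rewrite !(corner_mulE, corner_valD) mulrDl.
Qed.

Lemma corner_mulDr : right_distributive corner_mul +%R.
Proof.
by move=> x y z; apply: val_inj; rewrite !(corner_mulE, corner_valD) mulrDr.
Qed.

Lemma corner_one_neq0 : corner_one != 0.
Proof.
by apply/eqP => /(congr1 \val); rewrite corner_oneE; exact: divi_neq0 de.
Qed.

HB.instance Definition _ := GRing.Zmodule_isNzRing.Build D
  corner_mulA corner_mul1r corner_mulr1 corner_mulDl corner_mulDr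
  corner_one_neq0.

(** The zero case follows the convention that inversion fixes non-units; with it, choice yields a
    total inverse function. *)
Lemma corner_inv_exists (x : D) : exists y : D,
  if x == 0 then y = x else y * x = 1 /\ x * y = 1.
Proof.
case: eqP => x0; first by exists x.
have [|y [yx xy]] := divi_inv de (x := \val x).
  by rewrite cornerP => vx; apply: x0; exact: val_inj.
rewrite cornerP in yx xy; exists (to_corner y).
split; apply: val_inj; rewrite corner_mulE corner_oneE /=.
  by rewrite -!mulrA corner_mull yx (divi_idem de).
by rewrite !mulrA corner_mulr xy (divi_idem de).
Qed.

Definition corner_inv : D -> D := projT1 (choice corner_inv_exists).

Lemma corner_invP (x : D) :
  if x == 0 then corner_inv x = x
  else corner_inv x * x = 1 /\ x * corner_inv x = 1.
Proof. exact: projT2 (choice corner_inv_exists) x. Qed.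

Definition corner_unit : pred D := fun x => x != 0.

Lemma corner_mulVr : {in corner_unit, left_inverse 1 corner_inv *%R}.
Proof.
by move=> x x0; have := corner_invP x; rewrite (negbTE (x0 : x != 0)) => -[].
Qed.

Lemma corner_divrr : {in corner_unit, right_inverse 1 corner_inv *%R}.
Proof.
by move=> x x0; have := corner_invP x; rewrite (negbTE (x0 : x != 0)) => -[].
Qed.

Lemma corner_unitP (x y : D) : y * x = 1 /\ x * y = 1 -> corner_unit x.
Proof.
by move=> [yx _]; apply: contra_eq_neq yx => ->; rewrite mulr0 eq_sym oner_neq0.
Qed.

Lemma corner_inv_out : {in [predC corner_unit], corner_inv =1 id}.
Proof.
move=> x /negPn x0; have := corner_invP x.
by rewrite (x0 : x == 0).
Qed.

HB.instance Definition _ := GRing.NzRing_hasMulInverse.Build D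
  corner_mulVr corner_divrr corner_unitP corner_inv_out.

Section Coordinates.
Variables (n : nat) (u v : 'I_n -> R).
Hypothesis sum_uv : 1 = \sum_(i < n) u i * e * v i.
Hypothesis dual_uv : forall i j, e * (v i * u j) * e = e *+ (i == j).

Definition corner_matrix (r : R) : 'M[D]_n :=
  \matrix_(i, j) to_corner (v i * r * u j).

Lemma corner_matrixE r i j :
  \val (corner_matrix r i j) = e * (v i * r * u j) * e.
Proof. by rewrite mxE. Qed.

Lemma corner_matrix_nmod : nmod_morphism corner_matrix.
Proof.
split=> [|r s]; apply/matrixP => i j; apply: val_inj.
  by rewrite corner_matrixE mxE mulr0 mul0r mulr0 mul0r.
rewrite [in RHS]mxE corner_valD !corner_matrixE.
by rewrite !(mulrDr, mulrDl).
Qed.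

Lemma val_corner_sum (I : Type) (s : seq I) (F : I -> D) :
  \val (\sum_(i <- s) F i) = \sum_(i <- s) \val (F i).
Proof. exact: raddf_sum. Qed.

(** Inserting 1 = sum_k u_k e v_k between r and s produces the matrix product; duality turns 1 into
    the identity matrix. *)
Lemma corner_matrix_monoid : GRing.monoid_morphism corner_matrix.
Proof.
split=> [|r s]; apply/matrixP => i j; apply: val_inj;
  rewrite corner_matrixE [in RHS]mxE.
  by rewrite mulr1 dual_uv; case: (i == j); rewrite ?corner_oneE.
have -> : v i * (r * s) * u j = \sum_k v i * r * u k * e * (v k * s * u j).
  rewrite -[r in LHS]mulr1 sum_uv mulr_sumr !mulr_suml mulr_sumr mulr_suml.
  by apply: eq_bigr => k _; rewrite !mulrA.
rewrite val_corner_sum mulr_sumr mulr_suml; apply: eq_bigr => k _.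
rewrite corner_mulE !corner_matrixE -!mulrA (mulrA e e).
by rewrite (divi_idem de).
Qed.

HB.instance Definition _ :=
  GRing.isNmodMorphism.Build R 'M[D]_n corner_matrix corner_matrix_nmod.
HB.instance Definition _ :=
  GRing.isMonoidMorphism.Build R 'M[D]_n corner_matrix corner_matrix_monoid.

(** Expanding both units in r = 1 r 1 recovers r from its matrix; conversely, duality extracts each
    entry from the double sum. *)
Lemma corner_matrix_bij : bijective corner_matrix.
Proof.
exists (fun A : 'M[D]_n => \sum_i \sum_j u i * \val (A i j) * v j) => [r|A].
  transitivity (1 * r * 1); last by rewrite mul1r mulr1.
  rewrite sum_uv !mulr_suml; apply: eq_bigr => i _; rewrite mulr_sumr.
  by apply: eq_bigr => j _; rewrite corner_matrixE !mulrA.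
apply/matrixP => i j; apply: val_inj; rewrite corner_matrixE.
have term k l : e * (v i * (u k * \val (A k l) * v l) * u j) * e
    = if (k == i) && (l == j) then \val (A i j) else 0.
  transitivity (e * (v i * u k) * e * \val (A k l) * (e * (v l * u j) * e)).
    by rewrite -{1}cornerP !mulrA.
  rewrite !dual_uv; have [<-|ki] := eqVneq i k; last first.
    by rewrite !mul0r.
  have [->|lj] := eqVneq l j; last by rewrite mulr0.
  by rewrite corner_mull corner_mulr.
rewrite mulr_sumr !mulr_suml mulr_sumr mulr_suml.
under eq_bigr => k _.
  rewrite mulr_sumr !mulr_suml mulr_sumr mulr_suml.
  under eq_bigr => l _ do rewrite term.
  over.
rewrite (bigD1 i) //= (bigD1 j) //= !eqxx big1 => [|l /negbTE ->]; last by [].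
rewrite big1 ?addr0 // => k /negbTE ki.
by rewrite big1 // => l _; rewrite ki.
Qed.

Lemma corner_matrix_isomorphic : isomorphic R 'M[D]_n.
Proof. by exists corner_matrix; exact: corner_matrix_bij. Qed.
End Coordinates.
End Corner.

(** Expanding 1 in 1 u_j e = u_j e gives the linear relation sum_i u_i d_i = 0 with d_i = e v_i u_j
    e - delta_ij e. When d_i0 is nonzero it is invertible in e R e, so u_i0 e can be eliminated. *)
Lemma shorten_expansion (R : pzRingType) (e : R) n (u v : 'I_n.+1 -> R) i0 j :
    division_idempotent e -> 1 = \sum_(i < n.+1) u i * e * v i ->
    e * (v i0 * u j) * e <> e *+ (i0 == j) ->
  exists u' v' : 'I_n -> R, 1 = \sum_(i < n) u' i * e * v' i.
Proof.
move=> [ee e0 inv] sum_uv dij.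
pose d i := e * (v i * u j) * e - e *+ (i == j).
(* This puts [d i] in the form e x e required by [inv]. *)
have dE i : e * (v i * u j - 1 *+ (i == j)) * e = d i.
  rewrite mulrBr mulrBl /d; case: (i == j); last by rewrite !mulr0n mulr0 mul0r.
  by rewrite !mulr1n mulr1 ee.
have ed i : e * d i = d i by rewrite -dE !mulrA ee.
have [|y [_ dy]] := inv (v i0 * u j - 1 *+ (i0 == j)).
  by rewrite dE => d0; apply: dij; exact: subr0_eq.
rewrite dE in dy.
have sum_d : \sum_i u i * d i = 0.
  under eq_bigr do rewrite mulrBr.
  rewrite sumrB (bigD1 j (F := fun i => u i * (e *+ (i == j)))) //= eqxx.
  rewrite [X in _ - (_ + X)]big1 => [|i /negbTE ->]; last by rewrite mulr0.
  apply/eqP; rewrite addr0 subr_eq0; apply/eqP.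
  transitivity (1 * (u j * e)); last by rewrite mul1r.
  by rewrite sum_uv mulr_suml; apply: eq_bigr => i _; rewrite !mulrA.
(* By the relation, u_i0 e v_i0 = u_i0 d_i0 y v_i0 = - sum_k u_k d_k y v_i0 over k <> i0, which is
   absorbed into the v_k. *)
exists (fun k => u (lift i0 k)),
  (fun k => v (lift i0 k) - d (lift i0 k) * y * v i0).
rewrite [LHS]sum_uv (bigD1_ord i0) //=.
under [RHS]eq_bigr do rewrite mulrBr !mulrA -(mulrA _ e (d _)) ed.
rewrite sumrB addrC; congr (_ + _); rewrite (bigD1_ord i0) //= in sum_d.
transitivity (u i0 * d i0 * y * v i0); first by rewrite -dy !mulrA.
have -> : u i0 * d i0 = - \sum_i u (lift i0 i) * d (lift i0 i).
  by apply/eqP; rewrite -addr_eq0 sum_d.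
by rewrite !mulNr !mulr_suml; congr (- _);
  apply: eq_bigr => i _; rewrite !mulrA.
Qed.

Lemma isomorphic_matrix (R : pzRingType) (e : R) :
    ideal_simple R -> division_idempotent e ->
  exists (F : unitRingType) (n : nat),
    [/\ division_ring F, (1 <= n)%N & isomorphic R 'M[F]_n].
Proof.
move=> iR de; have [ee e0 _] := de.
pose P n := `[< exists u v : 'I_n -> R, 1 = \sum_(i < n) u i * e * v i >].
have exP : exists n, P n.
  have [n [u [v uv]]] := full_idempotent iR ee e0.
  by exists n; apply/asboolP; exists u, v.
case: (ex_minnP exP) => -[|n] /asboolP[u [v uv]] minn.
  (* An empty expansion would give 1 = 0 and hence e = 0. *)
  by case: e0; rewrite -[LHS]mul1r uv big_ord0 mul0r.
have dual i j : e * (v i * u j) * e = e *+ (i == j).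
  apply: contrapT => /(shorten_expansion de uv)/asboolP/minn.
  by rewrite ltnn.
exists (corner de), n.+1; split=> //.
exact: corner_matrix_isomorphic uv dual.
Qed.

Definition matrix_or_endomorphism_semiring (R : pzSemiRingType) : Prop :=
  (exists (F : unitRingType) (n : nat),
     [/\ division_ring F, (1 <= n)%N & isomorphic R 'M[F]_n]) \/
  (exists (d : Order.disp_t) (M : finTBDistrLatticeType d),
     (exists x : M, x != \bot%O) /\ isomorphic R (join_endo M)).

Lemma isomorphic_join_endo (R : pzSemiRingType) n (e : R) (u v : 'I_n -> R) :
    boolean_frame e u v ->
  exists (d : Order.disp_t) (M : finTBDistrLatticeType d),
    (exists x : M, x != \bot%O) /\ isomorphic R (join_endo M).
Proof.
move=> uv; exists (Order.Disp tt tt), (frame_lattice uv); split; last first.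
  by exists (frame_action uv); exact: frame_action_bij.
have ee : e * e == e by rewrite (frame_idem uv).
exists (exist (fun q => q * e == q) e ee : frame_lattice uv).
by apply/eqP => /(congr1 \val); exact: frame_neq0 uv.
Qed.

Lemma structure_of_simple (R : pzSemiRingType) (e : R) :
  simple_semiring R -> division_idempotent e ->
  matrix_or_endomorphism_semiring R.
Proof.
move=> sR de; pose V := [set x : R | exists y, x + y = 0]%classic.
have idV : ideal V.
  have V0 : V 0 by exists 0; rewrite addr0.
  have VD x y : V x -> V y -> V (x + y).
    by move=> [x' xx'] [y' yy']; exists (x' + y');
      rewrite addrACA xx' yy' addr0.
  split; split=> // r x [y xy].
    by exists (r * y); rewrite -mulrDr xy mulr0.
  by exists (y * r); rewrite -mulrDl xy mul0r.
have [V0|VT] := sR.1 _ idV; [right|left].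
  have [|n [u [v uv]]] := zerosumfree_boolean_frame sR de.
    by move=> x y xy; have : V x; [exists y|rewrite V0].
  exact: isomorphic_join_endo uv.
have [|R' RR'] := @semiring_with_opposite R.
  by move=> x; have : V x by rewrite VT.
by case: sR => iR _; subst R; exact: isomorphic_matrix de.
Qed.

(** * Simplicity of matrix and endomorphism semirings *)

Section Expansion.
Variables (R : pzSemiRingType) (e : R) (T : finType) (u v : T -> R).
Hypothesis de : division_idempotent e.
Hypothesis sum_uv : 1 = \sum_i u i * e * v i.

Lemma expansion_eq (x y : R) :
  (forall i j, e * (v i * x * u j) * e = e * (v i * y * u j) * e) -> x = y.
Proof.
have xE z : z = \sum_i \sum_j u i * (e * (v i * z * u j) * e) * v j.
  rewrite -[LHS]mul1r -[LHS]mulr1 sum_uv !mulr_suml; apply: eq_bigr => i _.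
  by rewrite mulr_sumr; apply: eq_bigr => j _; rewrite !mulrA.
move=> xy; rewrite (xE x) (xE y); apply: eq_bigr => i _.
by apply: eq_bigr => j _; rewrite xy.
Qed.

(** A nonzero x in the ideal has a nonzero coordinate e v_i x u_j e; inverting it puts [e], then 1 =
    sum_k u_k e v_k, in the ideal. *)
Lemma expansion_ideal_simple : ideal_simple R.
Proof.
move=> I [[I0 ID IMl] [_ _ IMr]].
have [Isub|nI] := pselect (forall x, I x -> x = 0); [left|right].
  by apply/seteqP; split=> x /=; [exact: Isub|move->].
have /existsNP[x /not_implyP[Ix x0]] := nI.
have [i [j xij]] : exists i j, e * (v i * x * u j) * e <> 0.
  apply: contrapT => nij; apply: x0; apply: expansion_eq => i j.
  rewrite mulr0 mul0r mulr0 mul0r; apply: contrapT => xij.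
  by apply: nij; exists i, j.
have [y [ye _]] := divi_inv de xij.
have Ie : I e.
  by rewrite -ye; exact: IMl (IMr _ _ (IMl _ _ (IMr _ _ (IMl _ _ Ix)))).
have I1 : I 1.
  by rewrite sum_uv; elim/big_ind: _ => // k _; apply: IMr; exact: IMl.
by apply/seteqP; split=> // z _; rewrite -[z]mulr1; exact: IMl.
Qed.

(** Distinct congruent elements differ in some coordinate, where the hypothesis yields e ~ 0; the
    expansion then gives 1 ~ 0, and so z ~ 0 for all z. *)
Lemma expansion_congruence_simple :
    (forall c, congruence c -> forall x y,
       c (e * x * e) (e * y * e) -> e * x * e <> e * y * e -> c e 0) ->
  congruence_simple R.
Proof.
move=> ce c cc; have [cr cs ct cD cM] := cc.
have [cE|nc] := pselect (forall x y, c x y -> x = y); [left|right].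
  by move=> x y; split=> [|->]; [exact: cE|exact: cr].
have /existsNP[x /existsNP[y /not_implyP[cxy xy]]] := nc.
have [i [j xyij]] : exists i j,
    e * (v i * x * u j) * e <> e * (v i * y * u j) * e.
  apply: contrapT => nij; apply: xy; apply: expansion_eq => i j.
  by apply: contrapT => xyij; apply: nij; exists i, j.
have ce0 : c e 0.
  by apply: (ce c cc _ _ _ xyij); do ?[exact: cr | exact: cxy | apply: (cM)].
have c10 : c 1 0.
  rewrite sum_uv; elim/big_ind: _ => // [a b a0 b0|k _].
    by rewrite -[0]addr0; exact: cD.
  by rewrite -(mul0r (v k)) -(mulr0 (u k));
    do ?[exact: cr | exact: ce0 | apply: (cM)].
have c0 z : c z 0 by rewrite -[z]mulr1 -(mulr0 z); exact: cM.
by move=> a b; apply: ct (c0 a) (cs _ _ (c0 b)).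
Qed.

End Expansion.

(** Subtracting e y e gives e (x - y) e ~ 0 with the left side invertible in e R e. *)
Lemma ring_corner_congruence (R : pzRingType) (e : R) c x y :
    division_idempotent e -> congruence c ->
  c (e * x * e) (e * y * e) -> e * x * e <> e * y * e -> c e 0.
Proof.
move=> de [cr _ _ cD cM] cxy xy; have [|z [ze _]] := divi_inv de (x := x - y).
  by rewrite mulrBr mulrBl => /subr0_eq.
rewrite -ze -(mulr0 z); apply: cM => //.
rewrite mulrBr mulrBl -[0](subrr (e * y * e)); exact: cD.
Qed.

(** * Matrices over a division ring *)

Section MatrixSimple.
Variables (F : unitRingType) (n : nat).
Hypothesis divF : division_ring F.
Local Notation e := (delta_mx 0 0 : 'M[F]_n.+1).

Lemma delta_corner (A : 'M[F]_n.+1) : e * A * e = A 0 0 *: e.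
Proof.
apply/matrixP => i j; rewrite !mxE (bigD1 0) //= big1 => [|k /negbTE k0].
  rewrite addr0 !mxE (bigD1 0) //= big1 => [|k /negbTE k0].
    by rewrite addr0 !mxE; case: (i == 0);
      rewrite !(andbT, mul1r, mul0r, mulr0).
  by rewrite !mxE k0 andbF mul0r.
by rewrite !mxE k0 mulr0.
Qed.

Lemma delta_idem : e * e = e.
Proof. exact: mul_delta_mx. Qed.

Lemma delta_scale (a b : F) : (a *: e) * (b *: e) = (a * b) *: e.
Proof.
(* [F] may be noncommutative, so b cannot simply be pulled out of the right factor; writing b e as a
   corner lets idempotence absorb the left [e]. *)
have be : b *: e = e * b%:M * e by rewrite delta_corner mxE eqxx.
rewrite -[LHS]scalemxAl -scalerA; congr (_ *: _).
by rewrite be -[LHS]/(e * (e * b%:M * e)) !mulrA delta_idem.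
Qed.

Lemma delta_division_idempotent : division_idempotent e.
Proof.
split=> [|/matrixP/(_ 0 0)|x]; first exact: delta_idem.
  by rewrite !mxE; apply/eqP/oner_neq0.
rewrite delta_corner => x0.
have xU : x 0 0 \is a GRing.unit.
  by apply: divF; apply/eqP => x00; apply: x0; rewrite x00 scale0r.
by exists ((x 0 0)^-1 *: e); rewrite !delta_scale mulVr // mulrV // scale1r.
Qed.

Lemma matrix_simple : simple_semiring 'M[F]_n.+1.
Proof.
have sum_uv : 1 = \sum_i delta_mx i 0 * e * delta_mx 0 i :> 'M[F]_n.+1.
  rewrite -[LHS]/(1%:M) mx1_sum_delta; apply: eq_bigr => i _.
  by rewrite -!mulmxE !mul_delta_mx.
have de := delta_division_idempotent.
split; first exact: expansion_ideal_simple de sum_uv.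
apply: expansion_congruence_simple sum_uv _ => c cc x y.
exact: ring_corner_congruence.
Qed.

End MatrixSimple.

(** * Endomorphisms of a finite distributive lattice *)

Section EndomorphismSimple.
Variables (d : Order.disp_t) (M : finTBDistrLatticeType d).
Implicit Types (a c x y : M) (f : join_endo M).
Local Open Scope order_scope.

Definition step_fun a c x : M := if x <= a then \bot else c.

Lemma step_fun0 a c : step_fun a c \bot = \bot.
Proof. by rewrite /step_fun le0x. Qed.

Lemma step_funU a c : {morph step_fun a c : x y / x `|` y}.
Proof.
move=> x y; rewrite /step_fun leUx.
by case: (x <= a); case: (y <= a); rewrite ?joinxx ?join0x ?joinx0.
Qed.

Definition step a c : join_endo M := JoinEndo (step_fun0 a c) (@step_funU a c).

Lemma stepE a c x : step a c x = if x <= a then \bot else c.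
Proof. by []. Qed.

Lemma mul_step f a c : (f * step a c)%R = step a (f c).
Proof.
apply: join_endoP => x; rewrite !stepE /= /step_fun.
by case: ifP => //; rewrite join_endo0.
Qed.

Lemma step_bot a : step a \bot = 0%R.
Proof. by apply: join_endoP => x; rewrite stepE if_same. Qed.

Local Notation e := (step \bot \top).

(** By [mul_step] the product is the step from [\bot] with value [(e * f) \top], and [e] takes only
    the values [\bot] and [\top]. *)
Lemma step_corner f : (e * f * e = 0 \/ e * f * e = e)%R.
Proof.
rewrite mul_step /= /step_fun; case: ifP => _; last by right.
by left; exact: step_bot.
Qed.

Lemma join_endo_sum (I : Type) (s : seq I) (P : pred I)
    (F : I -> join_endo M) x :
  (\sum_(i <- s | P i) F i)%R x = \join_(i <- s | P i) F i x.
Proof.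
elim: s => [|i s IH]; first by rewrite !big_nil.
by rewrite !big_cons; case: (P i); rewrite -IH.
Qed.

(** Equivalently, [step p.1 p.2] lies pointwise below the identity. *)
Definition below_id (p : M * M) : bool :=
  [forall x, (x <= p.1) || (p.2 <= x)].

Lemma sum_step : \sum_(p | below_id p) step p.1 p.2 = 1%R.
Proof.
apply: join_endoP => x; rewrite join_endo_sum; apply/le_anti/andP; split.
  apply/joinsP => p /forallP/(_ x); rewrite stepE.
  by case: ifP => //= _; rewrite le0x.
(* An element minimal among those below [x] but not below [w] is join-prime. *)
set w := \join_(p | below_id p) _; apply: contraT => xw.
pose P c := (c <= x) && ~~ (c <= w).
have Px : P x by rewrite /P lexx.
pose down c := #|[set y | y <= c]|.
have [c /andP[cx cw] cmin] := arg_minnP down Px.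
have smaller y : y < c -> y <= w.
  move=> yc; apply: contraT => yw.
  have : (down c <= down y)%N.
    by apply: cmin; rewrite /P yw (le_trans (ltW yc)).
  rewrite leqNgt proper_card //; apply/properP; split.
    by apply/fintype.subsetP => z; rewrite !inE => /le_trans; apply; exact: ltW.
  by exists c; rewrite !inE ?lexx // lt_geF.
have c_prime y z : c <= y `|` z -> c <= y \/ c <= z.
  move=> cyz; have [|cy] := boolP (c <= y); [by left|right].
  apply: contraNT cw => cz; rewrite -(meet_idPl cyz) meetUr leUx.
  rewrite !smaller // lt_neqAle leIl andbT.
    by apply: contraNneq cz => cE; rewrite -cE leIr.
  by apply: contraNneq cy => cE; rewrite -cE leIr.
(* As c is join-prime, [a] is the largest element not above c, so every y satisfies y <= a or c <=
   y. *)
pose a := \join_(y | ~~ (c <= y)) y.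
have ca : ~~ (c <= a).
  rewrite /a; elim/big_rec: _ => [|y z cy cz].
    by apply: contra cw => /le_trans; apply; exact: le0x.
  by apply/negP => /c_prime[|]; exact/negP.
have bac : below_id (a, c).
  apply/forallP => y /=; have [|cy] := boolP (c <= y); first by rewrite orbT.
  by rewrite orbF; exact: (joins_sup (j := y)).
(* Since c <= x but not c <= a, also not x <= a; so [step a c] takes the value c at x, which forces
   c <= w. *)
case/negP: cw; rewrite /w; apply: joins_min bac _.
rewrite stepE /=; case: ifP => // xa.
by case/negP: ca; exact: le_trans cx xa.
Qed.

Hypothesis nontrivial : exists x : M, x != \bot.

Lemma top_neq_bot : (\top <= \bot :> M) = false.
Proof.
case: nontrivial => x x0; apply: contraNF x0 => t0.
by rewrite -lex0 (le_trans (lex1 x)).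
Qed.

Lemma step_division_idempotent : division_idempotent e.
Proof.
have ee : (e * e = e)%R by rewrite mul_step stepE top_neq_bot.
split=> // [/(congr1 (fun f : join_endo M => f \top))|f].
  rewrite stepE top_neq_bot => t0.
  by have := top_neq_bot; rewrite t0 lexx.
by case: (step_corner f) => -> // _; exists e.
Qed.

Lemma join_endo_simple : simple_semiring (join_endo M).
Proof.
(* The product u_p e v_p is [step p.1 p.2]; the value 0 removes the pairs outside [below_id], so
   that the sum runs over a whole finite type. *)
pose u (p : M * M) := if below_id p then step \bot p.2 else 0%R.
pose v (p : M * M) := step p.1 \top.
have sum_uv : (1 = \sum_p u p * e * v p)%R.
  rewrite -sum_step big_mkcond; apply: eq_bigr => p _; rewrite /u.
  case: ifP => _; last by rewrite !mul0r.
  by rewrite !mul_step !stepE !top_neq_bot.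
have de := step_division_idempotent.
split; first exact: expansion_ideal_simple de sum_uv.
apply: expansion_congruence_simple sum_uv _ => c [cr cs _ _ _] f g.
case: (step_corner f) (step_corner g) => -> [] -> //.
by move=> c0e _; exact: cs.
Qed.

End EndomorphismSimple.

(** * Transport along isomorphisms and the two equivalences *)

Lemma simple_isomorphic (R S : pzSemiRingType) :
    isomorphic R S -> simple_semiring S ->
    (exists e : S, division_idempotent e) ->
  simple_semiring R /\ exists e : R, division_idempotent e.
Proof.
move=> [f [g fK gK]] [iS cS] [e [ee e0 inv]].
have gD x y : g (x + y) = g x + g y.
  by apply: (can_inj fK); rewrite rmorphD !gK.
have gM x y : g (x * y) = g x * g y.
  by apply: (can_inj fK); rewrite rmorphM !gK.
have g0 : g 0 = 0 by apply: (can_inj fK); rewrite rmorph0 gK.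
have gI := can_inj gK.
split; last first.
  exists (g e); split=> [||x]; first by rewrite -gM ee.
    by rewrite -g0 => /gI.
  rewrite -[x]fK -!gM => x0.
  have [|y [yl yr]] := inv (f x); first by move=> fx; apply: x0; rewrite fx.
  by exists (g y); rewrite -!gM yl yr.
split.
  move=> I [[I0 ID IMl] [_ _ IMr]].
  have idJ : ideal [set y | I (g y)]%classic.
    have J0 : I (g 0) by rewrite g0.
    have JD x y : I (g x) -> I (g y) -> I (g (x + y)) by rewrite gD; exact: ID.
    by split; split=> // r x /=; rewrite gM; [exact: IMl | exact: IMr].
  have IJ x : I x = [set y | I (g y)]%classic (f x) by rewrite /= fK.
  have [JE|JE] := iS _ idJ; [left|right]; apply/seteqP; split=> x //=;
    rewrite IJ JE //=.
    by move=> fx; apply: (can_inj fK); rewrite fx rmorph0.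
  by move=> ->; rewrite rmorph0.
move=> c [cr cs ct cD cM].
have cc : congruence (fun x y => c (g x) (g y)).
  split=> [x|x y|x y z|x x' y y'|x x' y y'].
  - exact: cr.
  - exact: cs.
  - exact: ct.
  - by rewrite !gD; exact: cD.
  - by rewrite !gM; exact: cM.
have [cE|cT] := cS _ cc; [left|right] => x y.
  by rewrite -[x in c x _]fK -[y in c _ y]fK cE; split=> [/(can_inj fK)|->].
by rewrite -[x]fK -[y]fK.
Qed.

Lemma simple_of_structure (R : pzSemiRingType) :
    matrix_or_endomorphism_semiring R ->
  simple_semiring R /\ exists e : R, division_idempotent e.
Proof.
case=> [[F [n [divF]]]|[d [M [nt iso]]]].
  case: n => // n _ iso.
  apply: simple_isomorphic iso _ _; first exact: matrix_simple.
  by eexists; exact: delta_division_idempotent.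
apply: simple_isomorphic iso _ _; first exact: join_endo_simple.
by eexists; exact: step_division_idempotent.
Qed.

Lemma simple_with_projective_left_ideal (R : pzSemiRingType) :
  simple_semiring R /\ has_projective_minimal_left_ideal R <->
  simple_semiring R /\ exists e : R, division_idempotent e.
Proof.
split=> -[sR]; first by split=> //; exact: division_idempotent_of_projective.
move=> [e de]; split=> //; case: sR => iR _.
exact: projective_minimal_left_ideal_of_idempotent de.
Qed.

Lemma simple_with_projective_right_ideal (R : pzSemiRingType) :
  simple_semiring R /\ has_projective_minimal_right_ideal R <->
  simple_semiring R /\ exists e : R, division_idempotent e.
Proof.
rewrite projective_minimal_right_ideal_converse.
split=> -[sR].
  move=> /division_idempotent_of_projective[e de]; split=> //.
  by exists e; exact/converse_division_idempotent.
move=> [e /(converse_division_idempotent e).2 de]; split=> //.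
have [iR _] := converse_simple sR.
exact: projective_minimal_left_ideal_of_idempotent de.
Qed.

Theorem theorem5p11 (R : pzSemiRingType) :
  (simple_semiring R /\ has_projective_minimal_left_ideal R <->
     (exists (F : unitRingType) (n : nat),
        [/\ division_ring F, (1 <= n)%N & isomorphic R 'M[F]_n]) \/
     (exists (d : Order.disp_t) (M : finTBDistrLatticeType d),
        (exists x : M, x != \bot%O) /\ isomorphic R (join_endo M)))
  /\
  (simple_semiring R /\ has_projective_minimal_right_ideal R <->
     (exists (F : unitRingType) (n : nat),
        [/\ division_ring F, (1 <= n)%N & isomorphic R 'M[F]_n]) \/
     (exists (d : Order.disp_t) (M : finTBDistrLatticeType d),
        (exists x : M, x != \bot%O) /\ isomorphic R (join_endo M))).
Proof.
have classify : (simple_semiring R /\ exists e : R, division_idempotent e) <->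
    matrix_or_endomorphism_semiring R.
  split=> [[sR [e de]]|]; first exact: structure_of_simple de.
  exact: simple_of_structure.
split; apply: iff_trans classify.
  exact: simple_with_projective_left_ideal.
exact: simple_with_projective_right_ideal.
Qed.
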